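(* Let $n\ge1$ and $0<q_1\le p_1=p_2<q_2<\infty$. Assume that $v_1,v_2\in\mathcal W(\mathbb R^n)$ and $w_1,w_2\in\mathcal W(0,\infty)$ are such that $\int_t^\infty w_i^{q_i}<\infty$, $i=1,2$, for all $t\in(0,\infty)$. Write $LM_i:=LM_{p_i,q_i}(v_i,w_i)$, $i=1,2$. Then $LM_1\hookrightarrow LM_2$ if and only if $I_{10}<\infty$, where $$I_{10}:=\sup_{x\in(0,\infty)}\bigg(\int_x^\infty w_2(s)^{q_2}\,ds\bigg)^{\frac1{q_2}}\operatorname*{ess\,sup}_{y\in B(0,x)}v_1(y)^{-1}v_2(y)\bigg(\int_{|y|}^\infty w_1(s)^{q_1}\,ds\bigg)^{-\frac1{q_1}}.$$ Moreover, $\|\mathrm I\|_{LM_1\to LM_2}\approx I_{10}$.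
   Context: $\mathcal M^+(\mathbb R^n)$ is the set of nonnegative measurable functions on $\mathbb R^n$. $\mathcal W(A)$ is the set of weights on $A$, i.e. measurable functions on $A$ that are positive and finite a.e. $B(0,t)$ is the open ball in $\mathbb R^n$ centred at $0$ of radius $t$. For $p,q\in(0,\infty)$, the weighted local Morrey-type space $LM_{p,q}(v,w)$ is the collection of all functions $f\in L^{loc}_{p,v}(\mathbb R^n)$ (locally $fv\in L_p$) such that $$\|f\|_{LM_{p,q}(v,w)}=\bigg(\int_0^\infty\bigg(\int_{B(0,t)}|f(s)|^pv(s)^p\,ds\bigg)^{\frac qp}w(t)^q\,dt\bigg)^{\frac1q}<\infty.$$ $X\hookrightarrow Y$ means $X\subset Y$ and there is a constant $C>0$ with $\|z\|_Y\le C\|z\|_X$ for all $z\in X$; here this amounts to $\|f\|_{LM_2}\le C\|f\|_{LM_1}$ for all $f\in\mathcal M^+(\mathbb R^n)$. $\|\mathrm I\|_{LM_1\to LM_2}=\sup_{f\in\mathcal M^+(\mathbb R^n)}\|f\|_{LM_2}/\|f\|_{LM_1}$ is the best such constant. $\int_t^\infty w_i^{q_i}$ means $\int_t^\infty w_i(s)^{q_i}\,ds$. $A\approx B$ means $\lambda^{-1}B\le A\le\lambda B$ for some constant $\lambda>0$ depending only on inessential parameters (at most on $n,p_1,p_2,q_1,q_2$, not on the weights). *)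

(* Defs.v *)
From HB Require Import structures.
From mathcomp Require Import all_boot all_order all_algebra.
From mathcomp Require Import all_classical all_reals all_analysis.
From mathcomp Require Import measurable_realfun ess_sup_inf.

Set Implicit Arguments.
Unset Strict Implicit.
Unset Printing Implicit Defensive.

Import Order.TTheory GRing.Theory Num.Theory.
Import numFieldNormedType.Exports.

Local Open Scope classical_set_scope.
Local Open Scope ring_scope.
Local Open Scope ereal_scope.

Section product_step.
Context (R : realType) (n : nat).
Variable m : {sigma_finite_measure set (n.-tuple R) -> \bar R}.

Definition cons_pair (x : R * n.-tuple R) : n.+1.-tuple R :=
  [tuple of x.1 :: x.2].

Lemma measurable_cons_pair : measurable_fun [set: R * n.-tuple R] cons_pair.
Proof. exact: measurable_cons. Qed.

Definition lebesgue_cons : set (n.+1.-tuple R) -> \bar R :=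
  pushforward (lebesgue_measure \x m) cons_pair.

Let lebesgue_cons0 : lebesgue_cons set0 = 0.
Proof. by rewrite /lebesgue_cons /pushforward preimage_set0 measure0. Qed.

Let lebesgue_cons_ge0 A : 0 <= lebesgue_cons A.
Proof. by rewrite /lebesgue_cons /pushforward; exact: measure_ge0. Qed.

Let lebesgue_cons_sigma_additive : semi_sigma_additive lebesgue_cons.
Proof.
move=> F mF tF mUF; rewrite /lebesgue_cons /pushforward preimage_bigcup.
have mpre A : measurable A -> measurable (cons_pair @^-1` A).
  by move=> mA; rewrite -[X in measurable X]setTI; exact: measurable_cons_pair.
apply: measure_semi_sigma_additive => /=.
- by move=> k; exact: mpre (mF k).
- apply/trivIsetP => /= i j _ _ ij; rewrite -preimage_setI.
  by move/trivIsetP : tF => /(_ _ _ _ _ ij) ->//; rewrite preimage_set0.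
- rewrite -preimage_bigcup; exact: mpre mUF.
Qed.

HB.instance Definition _ := isMeasure.Build _ _ _ lebesgue_cons
  lebesgue_cons0 lebesgue_cons_ge0 lebesgue_cons_sigma_additive.

Let lebesgue_cons_sigma_finite : sigma_finite setT lebesgue_cons.
Proof.
have /sigma_finiteP[F [TF ndF Foo]] :=
  sigma_finiteT (@lebesgue_measure R).
have /sigma_finiteP[G [TG ndG Goo]] := sigma_finiteT m.
pose uncons (y : n.+1.-tuple R) := (thead y, [tuple of behead y]).
have muncons : measurable_fun setT uncons.
  apply/measurable_fun_pairP; split; last exact: measurable_behead.
  exact: measurable_tnth.
exists (fun k => uncons @^-1` (F k `*` G k)).
  rewrite predeqE => y; split=> // _.
  have [i _ Fi] : (\bigcup_k F k) (thead y) by rewrite -TF.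
  have [j _ Gj] : (\bigcup_k G k) [tuple of behead y] by rewrite -TG.
  exists (maxn i j) => //; split => /=.
  - by move: Fi; exact/subsetPset/ndF/leq_maxl.
  - by move: Gj; exact/subsetPset/ndG/leq_maxr.
move=> k; have [mF Fk] := Foo k; have [mG Gk] := Goo k; split.
  by rewrite -[X in measurable X]setTI; apply: muncons => //; exact: measurableX.
rewrite /lebesgue_cons /pushforward.
rewrite (_ : _ @^-1` _ = F k `*` G k).
  by rewrite product_measure1E// lte_mul_pinfty// ge0_fin_numE.
suff uconsK : cancel cons_pair uncons.
  by rewrite -comp_preimage (_ : uncons \o _ = id)//; exact/funext/uconsK.
by case=> x t; congr pair; exact/val_inj.
Qed.

HB.instance Definition _ := Measure_isSigmaFinite.Build _ _ _ lebesgue_cons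
  lebesgue_cons_sigma_finite.

End product_step.

(* The n-fold product of the Lebesgue measure of R, on the Borel sets of R^n
   (for n = 0, the unit mass of the point R^0). *)
Fixpoint borel_lebesgue (R : realType) (n : nat) :
    {sigma_finite_measure set (n.-tuple R) -> \bar R} :=
  if n is k.+1 then lebesgue_cons (borel_lebesgue R k)
  else dirac ([tuple] : 0.-tuple R).

Notation Rline R := (caratheodory_type ((wlength (R := R) idfun)^*)%mu).
Notation Rn R n := (caratheodory_type ((borel_lebesgue R n)^*)%mu).

(* As completed_lebesgue_measure, in dimension n: defined on the
   Lebesgue-measurable sets, and not only on the Borel sets. *)
Definition lebesgue_Rn (R : realType) (n : nat) : set (Rn R n) -> \bar R :=
  @completed_measure_extension _ _ _ (borel_lebesgue R n).

HB.instance Definition _ (R : realType) (n : nat) :=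
  Measure.on (@lebesgue_Rn R n).

Section local_Morrey.
Context (R : realType) (n : nat).

Definition enorm (x : Rn R n) : R := Num.sqrt (\sum_(i < n) tnth x i ^+ 2)%R.

Definition oball0 (t : R) : set (Rn R n) := [set x | (enorm x < t)%R].

Lemma measurable_oball0 (t : R) : measurable (oball0 t).
Proof.
have msum : measurable_fun [set: n.-tuple R]
    (fun x : n.-tuple R => \sum_(i < n) tnth x i ^+ 2)%R.
  apply: measurable_sum => i; apply: measurable_funX; exact: measurable_tnth.
have msqrt : measurable_fun [set: R] (@Num.sqrt R).
  by apply: continuous_measurable_fun; exact: sqrt_continuous.
have mball := measurableT_comp msqrt msum.
have -> : oball0 t = [set: n.-tuple R] `&` (fun x : n.-tuple R =>
    Num.sqrt (\sum_(i < n) tnth x i ^+ 2)%R) @^-1` `]-oo, t[.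
  by rewrite setTI predeqE => x; rewrite /oball0 /= in_itv.
apply: sub_caratheodory; apply: sub_sigma_algebra.
by apply: mball => //; exact: measurable_itv.
Qed.

Definition weight d (T : measurableType d) (mu : {measure set T -> \bar R})
    (A : set T) (w : T -> \bar R) : Prop :=
  measurable_fun A w /\ {ae mu, forall x, A x -> 0 < w x < +oo}.

Definition Mplus : set (Rn R n -> \bar R) :=
  [set f | measurable_fun setT f /\ forall x, 0 <= f x].

(* f v in L_p on every ball centred at 0, hence on every bounded set. *)
Definition Lploc (p : R) (v : Rn R n -> \bar R) : set (Rn R n -> \bar R) :=
  [set f | measurable_fun setT f /\
    forall r : R, (0 < r)%R ->
      \int[@lebesgue_Rn R n]_(x in oball0 r) (`|f x * v x| `^ p) < +oo].

Definition LMnorm (p q : R) (v : Rn R n -> \bar R) (w : Rline R -> \bar R)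
    (f : Rn R n -> \bar R) : \bar R :=
  (\int[@completed_lebesgue_measure R]_(t in `]0%R, +oo[)
     ((\int[@lebesgue_Rn R n]_(s in oball0 t) (`|f s| `^ p * v s `^ p))
        `^ (q / p) * w t `^ q)) `^ q^-1.

Definition LM (p q : R) (v : Rn R n -> \bar R) (w : Rline R -> \bar R) :
    set (Rn R n -> \bar R) :=
  [set f | Lploc p v f /\ LMnorm p q v w f < +oo].

(* In a quotient of extended reals x / 0 = +oo for x > 0, 0 / 0 = 0 and
   +oo / +oo = 0. *)
Definition LM_identity_norm (p1 q1 p2 q2 : R) (v1 v2 : Rn R n -> \bar R)
    (w1 w2 : Rline R -> \bar R) : \bar R :=
  ereal_sup [set LMnorm p2 q2 v2 w2 f / LMnorm p1 q1 v1 w1 f | f in Mplus].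

Definition tail_norm (q : R) (w : Rline R -> \bar R) (t : R) : \bar R :=
  (\int[@completed_lebesgue_measure R]_(s in `]t, +oo[) (w s `^ q)) `^ q^-1.

(* The power -1/q1 is written as the inverse of the power 1/q1: poweR sends
   +oo to +oo whatever the sign of the exponent. *)
Definition I10 (q1 q2 : R) (v1 v2 : Rn R n -> \bar R)
    (w1 w2 : Rline R -> \bar R) : \bar R :=
  ereal_sup [set tail_norm q2 w2 x *
      ess_sup (mrestr (@lebesgue_Rn R n) (measurable_oball0 x))
        (fun y => (v1 y)^-1 * v2 y * (tail_norm q1 w1 (enorm y))^-1)
    | x in `]0%R, +oo[].

End local_Morrey.

Definition embedded (R : realType) (F : Type) (X Y : set F)
    (normX normY : F -> \bar R) : Prop :=
  X `<=` Y /\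
  exists2 C : R, (0 < C)%R & forall z, X z -> normY z <= C%:E * normX z.

Definition equiv_up_to (R : realType) (lambda : R) (A B : \bar R) : Prop :=
  (lambda^-1)%:E * B <= A <= lambda%:E * B.

(* Main.v *)
(* Writing t |-> \int_(B(0,t)) g and y |-> \int_(|y|)^oo w^q as integrals over
   the sections of {(y, t) : |y| < t}, Minkowski's integral inequality gives,
   for p <= q2 and q1 <= p respectively, with W_i y = tail_norm q_i w_i |y|,
     ||f||_LM2 <= (\int (|f| v2 W_2)^p)^(1/p)   and
     (\int (|f| v1 W_1)^p)^(1/p) <= ||f||_LM1.
   Finiteness of I10 means v2 W_2 <= I10 v1 W_1 almost everywhere, so that I10
   bounds the embedding.  Conversely, one tests the embedding on f = 1_A / v1,
   where A lies in a ball, W_1 is constant up to a factor 2 on A, and the ratio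
   v2 / (v1 W_1) is large on A. *)
Require Import Defs.
From HB Require Import structures.
From mathcomp Require Import all_boot all_order all_algebra.
From mathcomp Require Import all_classical all_reals all_analysis.
From mathcomp Require Import measurable_realfun ess_sup_inf.
From mathcomp Require Import ring.

Set Implicit Arguments.
Unset Strict Implicit.
Unset Printing Implicit Defensive.

Import Order.TTheory GRing.Theory Num.Theory.
Import numFieldNormedType.Exports.

Local Open Scope classical_set_scope.
Local Open Scope ring_scope.
Local Open Scope ereal_scope.

(** Because p1 = p2, both Minkowski estimates (exponents q2/p and p/q1) end in integrals over R^n of
    the same |f|^p, so comparing two mixed norms becomes a pointwise comparison of v1 W_1 and v2
    W_2. Three obstacles shape the details. The usual proof of Minkowski's inequality divides by a
    power of an integral that may be infinite; here the inequality is proved for integrable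
    minorants of the integrand and then passed to the limit. The essential suprema in [I10] have
    exceptional null sets that vary with x, over an uncountable family; only rational radii are
    kept, and right continuity of the tails recovers the radius |y| itself. Likewise, in the
    converse, W_1 varies from point to point, and the set where the ratio is too large is covered by
    countably many test sets indexed by rational levels of W_1. The passage from [I10] to the
    embedding loses no constant; the only loss is the factor 2 between consecutive levels in the
    test sets. *)

(** * Minkowski's integral inequality over the sections of a set in a product *)

Section hoelder_power.
Context d (T : measurableType d) (R : realType).
Variable mu : {measure set T -> \bar R}.

(** Hoelder's inequality with exponents [r] and [(1 - r^-1)^-1]; for [r = 1] the second is infinite
    and both sides equal the integral of [a]. If that integral is infinite, positivity of the
    integral of [h] makes the right side [+oo]; otherwise [a] is finite almost everywhere and is
    replaced by [fine (a x)]. *)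
Lemma hoelder_power (a : T -> \bar R) (h : T -> R) (r : R) :
  measurable_fun setT a -> (forall x, 0 <= a x) ->
  measurable_fun setT h -> (forall x, (0 <= h x)%R) -> (1 <= r)%R ->
  0 < \int[mu]_x (h x)%:E ->
  \int[mu]_x ((h x)%:E `^ (1 - r^-1) * a x `^ r^-1) <=
  (\int[mu]_x a x) `^ r^-1 * (\int[mu]_x (h x)%:E) `^ (1 - r^-1).
Proof.
move=> ma a0 mh h0 r1 S0.
have r0 : (0 < r)%R by exact: lt_le_trans r1.
have [->|rneq1] := eqVneq r 1%R.
  rewrite invr1 subrr poweRe0 mule1 poweRe1; last exact: integral_ge0.
  by under eq_integral => x _ do rewrite poweRe0 mul1e (poweRe1 (a0 x)).
have rgt1 : (1 < r)%R by rewrite lt_neqAle eq_sym rneq1.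
have r'0 : (0 < 1 - r^-1)%R by rewrite subr_gt0 invf_lt1.
have [aoo|] := eqVneq (\int[mu]_x a x) +oo.
  rewrite aoo poweRyr ?invr_eq0 ?gt_eqF// gt0_mulye ?leey//.
  exact: poweR_gt0.
rewrite -ltey => aoo.
have ia : mu.-integrable setT a.
  apply/integrableP; split => //.
  by under eq_integral do rewrite gee0_abs//.
pose f x := fine (a x).
have mf : measurable_fun setT f by exact: measurableT_comp.
have f0 x : (0 <= f x)%R by exact: fine_ge0.
have aef : ae_eq mu setT a (EFin \o f).
  have := integrable_ae measurableT ia.
  by apply: filterS => x /(_ I) ax _; rewrite /= fineK.
have mpf : measurable_fun setT (fun x => f x `^ r^-1)%R.
  exact: measurableT_comp (measurable_powR _) mf.
have mph : measurable_fun setT (fun x => h x `^ (1 - r^-1))%R.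
  exact: measurableT_comp (measurable_powR _) mh.
have := @hoelder _ _ _ mu _ _ (1 - r^-1)^-1%R r mph mpf.
rewrite invr_gt0 => /(_ r'0 r0); rewrite invrK subrK => /(_ erefl).
rewrite Lnorm1.
under eq_integral => x _.
  rewrite /= ger0_norm; last by rewrite mulr_ge0 ?powR_ge0.
  rewrite EFinM -!poweR_EFin; over.
rewrite unlock.
under [X in _ <= X `^ _ * _]eq_integral => x _.
  rewrite /= ger0_norm ?powR_ge0// -powRrM mulfV ?gt_eqF// powRr1//; over.
under [X in _ <= _ * X `^ _]eq_integral => x _.
  rewrite /= ger0_norm ?powR_ge0// -powRrM mulVf ?gt_eqF// powRr1//; over.
rewrite invrK muleC.
rewrite [X in _ <= X `^ _ * _ -> _](_ : _ = \int[mu]_x a x); last first.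
  apply: ae_eq_integral => //; first exact/measurable_EFinP.
  by apply: filterS aef => x + Ix => /(_ Ix) ->.
apply: le_trans; rewrite le_eqVlt; apply/orP; left; apply/eqP.
apply: ae_eq_integral => //.
- apply: emeasurable_funM.
    by apply: (measurableT_comp (measurable_poweR _)); exact/measurable_EFinP.
  exact: (measurableT_comp (measurable_poweR _)).
- apply: emeasurable_funM.
    by apply: (measurableT_comp (measurable_poweR _)); exact/measurable_EFinP.
  by apply: (measurableT_comp (measurable_poweR _)); exact/measurable_EFinP.
- by apply: filterS aef => x + Ix => /(_ Ix) ->.
Qed.

End hoelder_power.

Section fubini_section.
Context d1 d2 (X : measurableType d1) (Y : measurableType d2) (R : realType).
Variable mu : {sigma_finite_measure set X -> \bar R}.
Variable nu : {sigma_finite_measure set Y -> \bar R}.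
Variables (E : set (X * Y)) (a : X -> \bar R) (b : Y -> \bar R).
Hypotheses (mE : measurable E) (ma : measurable_fun setT a)
  (mb : measurable_fun setT b) (a0 : forall x, 0 <= a x)
  (b0 : forall y, 0 <= b y).

Let ab (z : X * Y) : \bar R := (a z.1 * b z.2) * (\1_E z)%:E.

Let mab : measurable_fun setT ab.
Proof.
apply: emeasurable_funM; last first.
  by apply/measurable_EFinP; exact: measurable_indic.
by apply: emeasurable_funM; exact: measurableT_comp.
Qed.

Let ab0 z : 0 <= ab z.
Proof. by rewrite !mule_ge0// lee_fin. Qed.

Lemma measurable_integral_xsection :
  measurable_fun setT (fun x => \int[nu]_(y in xsection E x) b y).
Proof.
rewrite (_ : (fun x => _) =
    fubini_F nu (fun z : X * Y => b z.2 * (\1_E z)%:E)).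
  apply: measurable_fun_fubini_tonelli_F => [|z].
    apply: emeasurable_funM; first exact: measurableT_comp.
    by apply/measurable_EFinP; exact: measurable_indic.
  by rewrite mule_ge0// lee_fin.
apply/funext => x; rewrite integral_mkcond epatch_indic.
apply: eq_integral => y _ /=; congr (_ * _%:E).
by rewrite !indicE mem_xsection.
Qed.

Lemma measurable_integral_ysection :
  measurable_fun setT (fun y => \int[mu]_(x in ysection E y) a x).
Proof.
rewrite (_ : (fun y => _) =
    fubini_G mu (fun z : X * Y => a z.1 * (\1_E z)%:E)).
  apply: measurable_fun_fubini_tonelli_G => [|z].
    apply: emeasurable_funM; first exact: measurableT_comp.
    by apply/measurable_EFinP; exact: measurable_indic.
  by rewrite mule_ge0// lee_fin.
apply/funext => y; rewrite integral_mkcond epatch_indic.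
apply: eq_integral => x _ /=; congr (_ * _%:E).
by rewrite !indicE mem_ysection.
Qed.

(** Both sides are iterated integrals of [a x * b y] times the indicator of [E], so Tonelli's
    theorem identifies them. *)
Lemma fubini_section :
  \int[mu]_x (a x * \int[nu]_(y in xsection E x) b y) =
  \int[nu]_y (b y * \int[mu]_(x in ysection E y) a x).
Proof.
transitivity (\int[mu]_x \int[nu]_y ab (x, y)).
  apply: eq_integral => x _; rewrite integral_mkcond epatch_indic.
  rewrite -ge0_integralZl//; last 2 first.
  - apply: emeasurable_funM => //; apply/measurable_EFinP.
    by apply: measurable_indic; exact: measurable_xsection.
  - by move=> y _; rewrite mule_ge0// lee_fin.
  apply: eq_integral => y _; rewrite /ab/= muleA; congr (_ * _%:E).
  by rewrite !indicE mem_xsection.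
rewrite fubini_tonelli//.
apply: eq_integral => y _.
rewrite [\int[mu]_(x in ysection E y) _]integral_mkcond epatch_indic.
rewrite -ge0_integralZl//; last 2 first.
- apply: emeasurable_funM => //; apply/measurable_EFinP.
  by apply: measurable_indic; exact: measurable_ysection.
- by move=> x _; rewrite mule_ge0// lee_fin.
apply: eq_integral => x _; rewrite /ab/= muleA [b y * _]muleC.
congr (_ * _%:E).
by rewrite !indicE mem_ysection.
Qed.

End fubini_section.

(** Dividing by the positive number [s] to the power [1 - r^-1] leaves a bound on the [r]-th root of
    [s]. For an infinite [s] this division would be meaningless. *)
Lemma powR_absorb (R : realType) (s c r : R) : (0 < r -> 0 < s ->
  s <= c * s `^ (1 - r^-1) -> s <= c `^ r)%R.
Proof.
move=> r0 s0 H.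
have {H} H : (s `^ r^-1 <= c)%R.
  rewrite -(ler_pM2r (powR_gt0 (1 - r^-1) s0)) -powRD; last first.
    by rewrite (gt_eqF s0) implybT.
  by rewrite addrC subrK (powRr1 (ltW s0)).
have c0 : (0 <= c)%R by exact: le_trans (powR_ge0 _ _) H.
rewrite -[leLHS](powRr1 (ltW s0)) -(mulVf (lt0r_neq0 r0)) powRrM.
by apply: ge0_ler_powR; rewrite ?nnegrE ?powR_ge0 ?(ltW r0).
Qed.

Section minkowski_section.
Context d1 d2 (X : measurableType d1) (Y : measurableType d2) (R : realType).
Variable mu : {sigma_finite_measure set X -> \bar R}.
Variable nu : {sigma_finite_measure set Y -> \bar R}.
Variables (E : set (X * Y)) (a : X -> \bar R) (b : Y -> \bar R) (r : R).
Hypotheses (mE : measurable E) (ma : measurable_fun setT a)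
  (mb : measurable_fun setT b) (a0 : forall x, 0 <= a x)
  (b0 : forall y, 0 <= b y) (r1 : (1 <= r)%R).

Let phi x := \int[nu]_(y in xsection E x) b y.
Let A := \int[nu]_y (b y * (\int[mu]_(x in ysection E y) a x) `^ r^-1).

Let r0 : (0 < r)%R. Proof. exact: lt_le_trans r1. Qed.

Let phi0 x : 0 <= phi x.
Proof. exact: integral_ge0. Qed.

Let mphi : measurable_fun setT phi.
Proof. exact: measurable_integral_xsection. Qed.

Let mpsi : measurable_fun setT
  (fun y => (\int[mu]_(x in ysection E y) a x) `^ r^-1).
Proof.
apply: (measurableT_comp (measurable_poweR _)).
exact: measurable_integral_ysection.
Qed.

(* Since [h `^ r^-1 <= a `^ r^-1 * phi], no power of [phi] survives below and
   the estimate of [h] by itself can be absorbed once [h] is integrable. *)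
Let minkowski_minorant (h : X -> R) : measurable_fun setT h ->
  (forall x, (0 <= h x)%R) -> (forall x, (h x)%:E <= a x * phi x `^ r) ->
  \int[mu]_x (h x)%:E < +oo -> \int[mu]_x (h x)%:E <= A `^ r.
Proof.
move=> mh h0 hle Soo; set S := \int[mu]_x (h x)%:E.
have [->|Sneq0] := eqVneq S 0; first exact: poweR_ge0.
have Sge0 : 0 <= S by apply: integral_ge0 => x _; rewrite lee_fin.
have Sgt0 : 0 < S by rewrite lt_neqAle eq_sym Sneq0.
pose c x := (h x)%:E `^ (1 - r^-1) * a x `^ r^-1.
have c0 x : 0 <= c x by rewrite mule_ge0 ?poweR_ge0.
have mc : measurable_fun setT c.
  apply: emeasurable_funM.
    by apply: (measurableT_comp (measurable_poweR _)); exact/measurable_EFinP.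
  exact: (measurableT_comp (measurable_poweR _)).
have hc x : (h x)%:E <= c x * phi x.
  have -> : (h x)%:E = (h x)%:E `^ (1 - r^-1) * (h x)%:E `^ r^-1.
    rewrite !poweR_EFin -EFinM; have [->|hx0] := eqVneq (h x) 0%R.
      by rewrite [X in (_ * X)%R]powR0 ?mulr0// invr_eq0 gt_eqF.
    by rewrite -powRD ?subrK ?powRr1// hx0 implybT.
  rewrite /c -muleA lee_wpmul2l ?poweR_ge0//.
  rewrite -[X in _ <= _ * X](poweRe1 (phi0 x)) -(mulfV (lt0r_neq0 r0)) poweRrM.
  rewrite -poweRM ?poweR_ge0//.
  apply: gt0_ler_poweR => //; first by rewrite invr_ge0 ltW.
  - by rewrite in_itv/= leey andbT lee_fin.
  - by rewrite in_itv/= leey andbT mule_ge0 ?poweR_ge0.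
(* Only [a] is cut off to the section. [h] is left whole, so that the second Hoelder factor is a
   power of [S] that does not depend on [y]. *)
have hoelder_c y : \int[mu]_(x in ysection E y) c x <=
    (\int[mu]_(x in ysection E y) a x) `^ r^-1 * S `^ (1 - r^-1).
  have mD : measurable (ysection E y) by exact: measurable_ysection.
  rewrite 2!(integral_mkcond (ysection E y)).
  have mDa : measurable_fun setT (a \_ (ysection E y)).
    by apply/(measurable_restrictT _ mD); exact: measurable_funTS.
  have Da0 x : 0 <= (a \_ (ysection E y)) x by exact: erestrict_ge0.
  apply: (le_trans _ (hoelder_power mDa Da0 mh h0 r1 Sgt0)).
  rewrite le_eqVlt; apply/orP; left; apply/eqP; apply: eq_integral => x _.
  rewrite !patchE; case: ifPn => // _.
  by rewrite poweR0r ?mule0// invr_eq0 gt_eqF.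
(* Exchanging the integrals turns the integral of [c * phi] into that of [b y] times the integral of
   [c] over the section at [y], where [hoelder_c] applies. *)
have SA : S <= A * S `^ (1 - r^-1).
  apply: (@le_trans _ _ (\int[mu]_x (c x * phi x))).
    apply: ge0_le_integral => //.
    - by move=> x _; rewrite lee_fin.
    - exact/measurable_EFinP.
    - exact: emeasurable_funM.
  rewrite fubini_section// muleC -ge0_integralZl ?poweR_ge0//; last 2 first.
  - exact: emeasurable_funM.
  - by move=> y _; rewrite mule_ge0 ?poweR_ge0.
  apply: ge0_le_integral => //.
  - by move=> y _; rewrite mule_ge0//; exact: integral_ge0.
  - by apply: emeasurable_funM => //; exact: measurable_integral_ysection.
  - by apply: measurable_funeM; exact: emeasurable_funM.
  - by move=> y _; rewrite muleCA lee_wpmul2l// muleC.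
have [->|] := eqVneq A +oo; first by rewrite poweRyr ?leey// gt_eqF.
rewrite -ltey => Aoo.
have A0 : 0 <= A.
  by apply: integral_ge0 => y _; rewrite mule_ge0 ?poweR_ge0.
have Sfin : S \is a fin_num by rewrite ge0_fin_numE.
have Afin : A \is a fin_num by rewrite ge0_fin_numE.
move: Sgt0 SA; rewrite -(fineK Sfin) -(fineK Afin) !poweR_EFin -EFinM !lee_fin.
by rewrite lte_fin; exact: powR_absorb.
Qed.

Import HBNNSimple.

(** The integrand may fail to be integrable, so absorption cannot be applied to it directly. A
    simple function below it, cut off to a set of finite measure, is bounded with finite integral;
    monotone convergence in the simple functions and then along the exhaustion gives the claim. *)
Lemma minkowski_section : \int[mu]_x (a x * phi x `^ r) <= A `^ r.
Proof.
pose u x := a x * phi x `^ r.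
have mu_ : measurable_fun setT u.
  apply: emeasurable_funM => //.
  exact: (measurableT_comp (measurable_poweR _)).
have u0 x : 0 <= u x by rewrite mule_ge0 ?poweR_ge0.
have /sigma_finiteP[F [TF ndF Foo]] := sigma_finiteT mu.
have mF n : measurable (F n) by have [] := Foo n.
rewrite -/u TF.
have := @ge0_nondecreasing_set_cvg_integral _ _ _ F u mu ndF mF
  (fun=> measurable_funTS mu_) (fun _ _ _ => u0 _).
move=> /cvg_lim <-//; apply: lime_le.
  apply: ereal_nondecreasing_is_cvgn.
  exact: ge0_nondecreasing_set_nondecreasing_integral
    ndF mF (fun=> measurable_funTS mu_) (fun _ _ _ => u0 _).
apply: nearW => n /=.
pose g := nnsfun_approx measurableT mu_.
have cvg_g x : EFin \o g ^~ x @ \oo --> u x.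
  by apply: cvg_nnsfun_approx => // y _; exact: u0.
have nd_g x : nondecreasing_seq (EFin \o g ^~ x).
  by move=> i j ij; rewrite lee_fin; exact/lefP/nd_nnsfun_approx.
have g_le k x : (g k x)%:E <= u x.
  have /cvg_lim <- // := cvg_g x.
  have /cvg_lim -> // := ereal_nondecreasing_cvgn (nd_g x).
  by apply: ereal_sup_ubound; exists k.
have mg k : measurable_fun (F n) (EFin \o g k).
  by apply/measurable_funTS; apply/measurable_EFinP.
rewrite (eq_integral (fun x => limn (EFin \o g ^~ x))); last first.
  by move=> x _; apply/esym/cvg_lim.
rewrite monotone_convergence//; last 2 first.
- by move=> k x _; rewrite lee_fin.
- by move=> x _; exact: nd_g.
apply: lime_le.
  apply: ereal_nondecreasing_is_cvgn => i j ij.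
  apply: ge0_le_integral => //.
  - by move=> x _; rewrite lee_fin.
  - exact: mg.
  - exact: mg.
  - by move=> x _; exact: nd_g.
apply: nearW => k.
pose h x := (g k x * \1_(F n) x)%R.
have -> : \int[mu]_(x in F n) (EFin \o g k) x = \int[mu]_x (h x)%:E.
  by rewrite integral_mkcond epatch_indic; apply: eq_integral.
have [M [_ Mg]] := simple_bounded (g k).
have h0 x : (0 <= h x)%R by rewrite mulr_ge0.
have mh : measurable_fun setT h.
  by apply: measurable_funM => //; exact: measurable_indic.
have hg x : (h x <= g k x)%R.
  by rewrite /h indicE; case: (_ \in _); rewrite ?mulr1 ?mulr0.
apply: minkowski_minorant => //.
- by move=> x; rewrite (le_trans _ (g_le k x))// lee_fin.
- apply: (@le_lt_trans _ _ (\int[mu]_x (`|M + 1|%:E * (\1_(F n) x)%:E))).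
    apply: ge0_le_integral => //.
    + by move=> x _; rewrite lee_fin.
    + exact/measurable_EFinP.
    + apply: emeasurable_funM => //; apply/measurable_EFinP.
      exact: measurable_indic.
    + move=> x _; rewrite -EFinM lee_fin /h ler_wpM2r//.
      have := Mg (M + 1)%R (ltr_pwDr ltr01 (lexx M)) x I.
      by move=> /le_trans /(_ (ler_norm _)); exact: le_trans (ler_norm _).
  rewrite ge0_integralZl//; last first.
    by apply/measurable_EFinP; exact: measurable_indic.
  rewrite integral_indic// setIT lte_mul_pinfty ?lee_fin//.
  by have [] := Foo n.
Qed.

End minkowski_section.

(** * Balls in R^n and half-lines as sections of one set *)

Lemma lebesgue_Rn_sigma_finite (R : realType) (n : nat) :
  sigma_finite setT (@lebesgue_Rn R n).
Proof. exact/completed_measure_extension_sigma_finite/sigma_finiteT. Qed.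

HB.instance Definition _ (R : realType) (n : nat) :=
  @Measure_isSigmaFinite.Build _ _ _ (@lebesgue_Rn R n)
    (@lebesgue_Rn_sigma_finite R n).

Section radial_sections.
Context (R : realType) (n : nat).
Local Notation mu := (@lebesgue_Rn R n).
Local Notation lam := (@completed_lebesgue_measure R).

Lemma measurable_Rline_id : measurable_fun [set: Rline R] (id : Rline R -> R).
Proof.
by move=> _ A mA; rewrite setTI; apply: sub_caratheodory.
Qed.

Lemma measurable_Rline (A : set R) : measurable A ->
  measurable (A : set (Rline R)).
Proof.
by move=> mA; rewrite -[A]setTI; exact: measurable_Rline_id.
Qed.

Lemma enorm_ge0 (x : Rn R n) : (0 <= enorm x)%R.
Proof. exact: sqrtr_ge0. Qed.

Lemma measurable_enorm : measurable_fun [set: Rn R n] (@enorm R n).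
Proof.
apply: (measurability _ (RGenInftyO.measurableE R)) => //.
move=> _ [_ [t ->] <-]; rewrite setTI.
rewrite (_ : _ @^-1` _ = oball0 t); first exact: measurable_oball0.
by apply/seteqP; split => x; rewrite /oball0/= in_itv.
Qed.

(** The set is needed with both orders of the coordinates: the two Minkowski inequalities below
    exchange the roles of R^n and the line. *)
Lemma measurable_radial_l :
  measurable [set z : Rn R n * Rline R | (enorm z.1 < z.2)%R].
Proof.
rewrite -[X in measurable X]setTI.
rewrite (_ : [set z | _] =
  (fun z : Rn R n * Rline R => enorm z.1 < z.2)%R @^-1` [set true]);
  last by apply/seteqP; split => z /=.
apply: measurable_fun_ltr => //.
- by apply: (measurableT_comp measurable_enorm); exact: measurable_fst.
- by apply: (measurableT_comp measurable_Rline_id); exact: measurable_snd.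
Qed.

Lemma measurable_radial_r :
  measurable [set z : Rline R * Rn R n | (enorm z.2 < z.1)%R].
Proof.
rewrite -[X in measurable X]setTI.
rewrite (_ : [set z | _] =
  (fun z : Rline R * Rn R n => enorm z.2 < z.1)%R @^-1` [set true]);
  last by apply/seteqP; split => z /=.
apply: measurable_fun_ltr => //.
- by apply: (measurableT_comp measurable_enorm); exact: measurable_snd.
- by apply: (measurableT_comp measurable_Rline_id); exact: measurable_fst.
Qed.

Context (g : Rn R n -> \bar R) (a : Rline R -> \bar R) (r : R).
Hypotheses (mg : measurable_fun setT g) (g0 : forall y, 0 <= g y)
  (ma : measurable_fun setT a) (a0 : forall t, 0 <= a t).

Let xsec_l (y : Rn R n) :
  xsection [set z : Rn R n * Rline R | (enorm z.1 < z.2)%R] y =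
  `]enorm y, +oo[%classic.
Proof.
by apply/seteqP; split => t; rewrite /xsection/= inE/= in_itv/= andbT.
Qed.

Let ysec_l (t : Rline R) :
  ysection [set z : Rn R n * Rline R | (enorm z.1 < z.2)%R] t = oball0 t.
Proof. by apply/seteqP; split => y; rewrite /ysection/= inE. Qed.

Let xsec_r (t : Rline R) :
  xsection [set z : Rline R * Rn R n | (enorm z.2 < z.1)%R] t = oball0 t.
Proof. by apply/seteqP; split => y; rewrite /xsection/= inE. Qed.

Let ysec_r (y : Rn R n) :
  ysection [set z : Rline R * Rn R n | (enorm z.2 < z.1)%R] y =
  `]enorm y, +oo[%classic.
Proof.
by apply/seteqP; split => t; rewrite /ysection/= inE/= in_itv/= andbT.
Qed.

Lemma measurable_integral_oball0 :
  measurable_fun setT (fun t : Rline R => \int[mu]_(y in oball0 t) g y).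
Proof.
have := measurable_integral_xsection mu measurable_radial_r mg g0.
by under eq_fun do rewrite xsec_r.
Qed.

Lemma measurable_integral_tail : measurable_fun setT
  (fun y : Rn R n => \int[lam]_(t in `]enorm y, +oo[) a t).
Proof.
have := measurable_integral_xsection lam measurable_radial_l ma a0.
by under eq_fun do rewrite xsec_l.
Qed.

Lemma minkowski_oball0 : (1 <= r)%R ->
  \int[lam]_t (a t * (\int[mu]_(y in oball0 t) g y) `^ r) <=
  (\int[mu]_y (g y * (\int[lam]_(t in `]enorm y, +oo[) a t) `^ r^-1)) `^ r.
Proof.
move=> r1; have := minkowski_section lam mu measurable_radial_r ma mg a0 g0 r1.
under eq_integral do rewrite xsec_r.
by under [X in _ <= X `^ _ -> _]eq_integral do rewrite ysec_r.
Qed.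

Lemma minkowski_tail : (1 <= r)%R ->
  \int[mu]_y (g y * (\int[lam]_(t in `]enorm y, +oo[) a t) `^ r) <=
  (\int[lam]_t (a t * (\int[mu]_(y in oball0 t) g y) `^ r^-1)) `^ r.
Proof.
move=> r1; have := minkowski_section mu lam measurable_radial_l mg ma g0 a0 r1.
under eq_integral do rewrite xsec_l.
by under [X in _ <= X `^ _ -> _]eq_integral do rewrite ysec_l.
Qed.

End radial_sections.

(** * Tails of a weight on the half-line *)

Section tails.
Context (R : realType).
Local Notation lam := (@completed_lebesgue_measure R).
Variable a : Rline R -> \bar R.
Hypotheses (ma : measurable_fun setT a) (a0 : forall t, 0 <= a t).

Lemma measurable_itv_Rline (i : interval R) :
  measurable ([set` i] : set (Rline R)).
Proof. by apply: measurable_Rline; exact: measurable_itv. Qed.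

Lemma le_integral_tail (x y : R) : (x <= y)%R ->
  \int[lam]_(t in `]y, +oo[) a t <= \int[lam]_(t in `]x, +oo[) a t.
Proof.
move=> xy; apply: ge0_subset_integral => //.
- exact: measurable_itv_Rline.
- exact: measurable_itv_Rline.
- exact: measurable_funTS.
- by move=> t /=; rewrite !in_itv/= !andbT; exact: le_lt_trans.
Qed.

(** Right continuity of the tail: the half-lines starting at [z + k.+1%:R^-1] increase to the open
    half-line at [z], and monotone convergence applies. *)
Lemma integral_tail_le (z : R) (c : \bar R) :
  (forall x, (z < x)%R -> \int[lam]_(t in `]x, +oo[) a t <= c) ->
  \int[lam]_(t in `]z, +oo[) a t <= c.
Proof.
move=> ac.
pose F (k : nat) : set (Rline R) := `](z + k.+1%:R^-1)%R, +oo[%classic.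
have -> : `]z, +oo[%classic = \bigcup_k F k.
  apply/seteqP; split => t /=; rewrite in_itv/= andbT.
    move=> /ltr_add_invr[k kt].
    by exists k => //=; rewrite /F/= in_itv/= andbT.
  move=> [k _]; rewrite /F/= in_itv/= andbT; apply: lt_trans.
  by rewrite ltrDl invr_gt0.
have ndF : nondecreasing_seq F.
  move=> i j ij; apply/subsetPset => t; rewrite /F/= !in_itv/= !andbT.
  by apply: le_lt_trans; rewrite lerD2l lef_pV2 ?posrE// ler_nat.
have mF k : measurable (F k) by exact: measurable_itv_Rline.
have := @ge0_nondecreasing_set_cvg_integral _ _ _ F a lam ndF mF
  (fun=> measurable_funTS ma) (fun _ _ _ => a0 _).
move=> /cvg_lim <-//; apply: lime_le.
  apply: ereal_nondecreasing_is_cvgn.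
  exact: ge0_nondecreasing_set_nondecreasing_integral
    ndF mF (fun=> measurable_funTS ma) (fun _ _ _ => a0 _).
by apply: nearW => k; apply: ac; rewrite ltrDl invr_gt0.
Qed.

Lemma integral_tail_gt0 (z : R) :
  {ae lam, forall t, (`]z, +oo[%classic : set (Rline R)) t -> 0 < a t} ->
  0 < \int[lam]_(t in `]z, +oo[) a t.
Proof.
move=> aew; rewrite lt_neqAle integral_ge0 ?andbT//; apply/eqP => /esym I0.
have mz : measurable (`]z, +oo[%classic : set (Rline R)).
  exact: measurable_itv_Rline.
have : \int[lam]_(t in `]z, +oo[) `|a t| = 0.
  by rewrite -[RHS]I0; apply: eq_integral => t _; rewrite gee0_abs.
move=> /ae_eq_integral_abs => /(_ mz (measurable_funTS ma)) ae0.
have : lam.-negligible (`]z, +oo[%classic : set (Rline R)).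
  have : \forall t \ae lam, ~ (`]z, +oo[%classic : set (Rline R)) t.
    apply: filterS2 aew ae0 => t /[swap] at0 + tz.
    by rewrite at0// => /(_ tz); rewrite ltxx.
  by apply: negligibleS => t tz /=; rewrite notK.
move=> /negligibleP => /(_ mz) z0.
(* On a half-line the completed measure unfolds to Lebesgue measure, whose value on intervals is
   known and here infinite. *)
have : lebesgue_measure (`]z, +oo[%classic : set R) = 0 by exact: z0.
by rewrite lebesgue_measure_itv/= ltry.
Qed.

End tails.

Lemma le_poweR (R : realType) (x y : \bar R) (r : R) :
  (0 <= r)%R -> 0 <= x -> x <= y -> x `^ r <= y `^ r.
Proof.
move=> r0 x0 xy; apply: gt0_ler_poweR => //; rewrite in_itv/= leey andbT//.
exact: le_trans xy.
Qed.

Lemma poweRK (R : realType) (x : \bar R) (r : R) :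
  r != 0%R -> 0 <= x -> (x `^ r) `^ r^-1 = x.
Proof. by move=> r0 x0; rewrite -poweRrM mulfV// poweRe1. Qed.

Lemma poweRVK (R : realType) (x : \bar R) (r : R) :
  r != 0%R -> 0 <= x -> (x `^ r^-1) `^ r = x.
Proof. by move=> r0 x0; rewrite -poweRrM mulVf// poweRe1. Qed.

Section weight_line.
Context (R : realType) (q : R) (w : Rline R -> \bar R).
Local Notation lam := (@completed_lebesgue_measure R).
Hypotheses (q0 : (0 < q)%R) (ww : weight lam `]0%R, +oo[ w).

(** A weight is only controlled on the positive half-line. Extending its power by 0 gives a
    measurable function on the whole line, the form in which the Minkowski inequalities are
    stated. *)
Definition weight_power : Rline R -> \bar R :=
  (fun t => w t `^ q) \_ (`]0%R, +oo[%classic : set (Rline R)).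

Lemma measurable_weight_power : measurable_fun setT weight_power.
Proof.
apply/(measurable_restrictT _ (measurable_itv_Rline _)).
by apply: (measurableT_comp (measurable_poweR _)); exact: ww.1.
Qed.

Lemma weight_power_ge0 t : 0 <= weight_power t.
Proof. by apply: erestrict_ge0 => ? _; exact: poweR_ge0. Qed.

Lemma tail_normE (x : R) : (0 <= x)%R ->
  tail_norm q w x = (\int[lam]_(t in `]x, +oo[) weight_power t) `^ q^-1.
Proof.
move=> x0; congr (_ `^ _); apply: eq_integral => t.
rewrite inE/= in_itv/= andbT => xt; rewrite /weight_power patchE ifT//.
by rewrite inE/= in_itv/= andbT (le_lt_trans x0).
Qed.

Lemma tail_norm_ge0 (x : R) : 0 <= tail_norm q w x.
Proof. exact: poweR_ge0. Qed.

Lemma tail_norm_gt0 (x : R) : (0 <= x)%R -> 0 < tail_norm q w x.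
Proof.
move=> x0; rewrite tail_normE//; apply: poweR_gt0; apply: integral_tail_gt0.
- exact: measurable_weight_power.
- exact: weight_power_ge0.
- have := ww.2; apply: filterS => t + /= xt.
  have t0 : (`]0%R, +oo[%classic : set (Rline R)) t.
    by move: xt; rewrite /= !in_itv/= !andbT; exact: le_lt_trans.
  move=> /(_ t0)/andP[wt0 _].
  by rewrite /weight_power patchE mem_set//; exact: poweR_gt0.
Qed.

Lemma le_tail_norm (x y : R) : (0 <= x)%R -> (x <= y)%R ->
  tail_norm q w y <= tail_norm q w x.
Proof.
move=> x0 xy; rewrite !tail_normE ?(le_trans x0)//; apply: le_poweR.
- by rewrite invr_ge0 ltW.
- by apply: integral_ge0 => t _; exact: weight_power_ge0.
- exact: (le_integral_tail measurable_weight_power weight_power_ge0 xy).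
Qed.

Lemma tail_norm_le (z : R) (c : \bar R) : (0 <= z)%R -> 0 <= c ->
  (forall x, (z < x)%R -> tail_norm q w x <= c) -> tail_norm q w z <= c.
Proof.
move=> z0 c0 zc; have qn0 : q != 0%R by rewrite gt_eqF.
have I0 x : 0 <= \int[lam]_(t in `]x, +oo[) weight_power t.
  by apply: integral_ge0 => t _; exact: weight_power_ge0.
rewrite tail_normE// -[leRHS](poweRK qn0 c0).
apply: le_poweR; rewrite ?invr_ge0 ?(ltW q0)//.
apply: integral_tail_le => [||x zx].
- exact: measurable_weight_power.
- exact: weight_power_ge0.
- rewrite -[leLHS](poweRVK qn0)//.
  apply: le_poweR; rewrite ?(ltW q0) ?poweR_ge0//.
  by rewrite -tail_normE ?zc// (le_trans z0)// ltW.
Qed.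

Lemma tail_norm_lty (x : R) :
  \int[lam]_(s in `]x, +oo[) (w s `^ q) < +oo -> tail_norm q w x < +oo.
Proof. exact: poweR_lty. Qed.

Lemma measurable_tail_norm (n : nat) :
  measurable_fun setT (fun y : Rn R n => tail_norm q w (enorm y)).
Proof.
under eq_fun do rewrite tail_normE ?enorm_ge0//.
apply: (measurableT_comp (measurable_poweR _)).
apply: measurable_integral_tail; first exact: measurable_weight_power.
exact: weight_power_ge0.
Qed.

End weight_line.

(** * Comparison of a Morrey-type norm with weighted L_p integrals *)

Section LMnorm_estimates.
Context (R : realType) (n : nat) (p q : R).
Context (v f : Rn R n -> \bar R) (w : Rline R -> \bar R).
Local Notation mu := (@lebesgue_Rn R n).
Local Notation lam := (@completed_lebesgue_measure R).
Hypotheses (p0 : (0 < p)%R) (q0 : (0 < q)%R)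
  (wv : weight mu setT v) (ww : weight lam `]0%R, +oo[ w)
  (mf : measurable_fun setT f).

Definition power_density y := `|f y| `^ p * v y `^ p.
Local Notation g := power_density.

Lemma measurable_power_density : measurable_fun setT g.
Proof.
apply: emeasurable_funM; apply: (measurableT_comp (measurable_poweR _)).
  exact: measurableT_comp.
exact: wv.1.
Qed.

Lemma power_density_ge0 y : 0 <= g y.
Proof. by rewrite mule_ge0 ?poweR_ge0. Qed.

Lemma LMnormE : LMnorm p q v w f = (\int[lam]_t (weight_power q w t *
  (\int[mu]_(y in oball0 t) g y) `^ (q / p))) `^ q^-1.
Proof.
congr (_ `^ _); rewrite integral_mkcond; apply: eq_integral => t _.
by rewrite /weight_power !patchE; case: ifPn => _; rewrite ?mul0e// muleC.
Qed.

Lemma LMnorm_ge0 : 0 <= LMnorm p q v w f.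
Proof. exact: poweR_ge0. Qed.

(** Keep only the radii t > x and shrink each ball B(0,t) to B(0,x): the inner integral becomes a
    constant. *)
Lemma LMnorm_lower (x : R) : (0 <= x)%R ->
  tail_norm q w x * (\int[mu]_(y in oball0 x) g y) `^ p^-1 <=
  LMnorm p q v w f.
Proof.
move=> x0; rewrite LMnormE tail_normE//.
have qp : ((q / p) / q = p^-1)%R by rewrite mulrAC mulfV ?mul1r// gt_eqF.
have Ig0 (t : R) : 0 <= \int[mu]_(y in oball0 t) g y.
  by apply: integral_ge0 => y _; exact: power_density_ge0.
have mw := measurable_weight_power q ww; have w0 := weight_power_ge0 q w.
have -> : (\int[mu]_(y in oball0 x) g y) `^ p^-1 =
    ((\int[mu]_(y in oball0 x) g y) `^ (q / p)) `^ q^-1.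
  by rewrite -poweRrM qp.
rewrite -poweRM ?poweR_ge0//; last exact: integral_ge0.
apply: le_poweR; first by rewrite invr_ge0 ltW.
  by rewrite mule_ge0 ?poweR_ge0//; exact: integral_ge0.
rewrite muleC -ge0_integralZl ?poweR_ge0//; last 2 first.
- exact: measurable_itv_Rline.
- exact: measurable_funTS.
have mI : measurable_fun setT (fun t : Rline R =>
    (\int[mu]_(y in oball0 t) g y) `^ (q / p)).
  apply: (measurableT_comp (measurable_poweR _)).
  apply: measurable_integral_oball0; first exact: measurable_power_density.
  exact: power_density_ge0.
have mwI := emeasurable_funM mw mI.
apply: (@le_trans _ _ (\int[lam]_(t in `]x, +oo[) (weight_power q w t *
  (\int[mu]_(y in oball0 t) g y) `^ (q / p)))); last first.
  apply: ge0_subset_integral => //; first exact: measurable_itv_Rline.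
  by move=> t _; rewrite mule_ge0 ?poweR_ge0.
apply: ge0_le_integral.
- exact: measurable_itv_Rline.
- by move=> t _; rewrite mule_ge0 ?poweR_ge0.
- by apply: measurable_funTS; exact: measurable_funeM.
- exact: measurable_funTS.
- move=> t /=; rewrite in_itv/= andbT => xt; rewrite muleC lee_wpmul2l//.
  apply: le_poweR => //; first by rewrite divr_ge0 ?ltW.
  apply: ge0_subset_integral.
  + exact: measurable_oball0.
  + exact: measurable_oball0.
  + by apply: measurable_funTS; exact: measurable_power_density.
  + by move=> y _; exact: power_density_ge0.
  + by move=> y /=; rewrite /oball0/= => /lt_trans; apply.
Qed.

Lemma LMnorm_le_integral : (p <= q)%R ->
  LMnorm p q v w f <=
  (\int[mu]_y (g y * tail_norm q w (enorm y) `^ p)) `^ p^-1.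
Proof.
move=> pq; have pn0 : p != 0%R by rewrite gt_eqF.
have qn0 : q != 0%R by rewrite gt_eqF.
(* Minkowski is applied with exponent [q / p]. This splitting exposes the outer power [q^-1] on both
   sides, and the [p]-th power of the tail norm is the tail integral to the power [(q / p)^-1]. *)
have rp : (p^-1 = (q / p) / q)%R by rewrite mulrAC mulfV ?mul1r.
rewrite LMnormE [X in _ <= _ `^ X]rp [leRHS]poweRrM.
apply: le_poweR; first by rewrite invr_ge0 ltW.
  apply: integral_ge0 => t _.
  by rewrite mule_ge0 ?poweR_ge0//; exact: weight_power_ge0.
under [X in _ <= X `^ _]eq_integral => y _.
  rewrite tail_normE ?enorm_ge0// -poweRrM mulrC -[X in _ `^ X]invf_div; over.
apply: minkowski_oball0.
- exact: measurable_power_density.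
- exact: power_density_ge0.
- exact: measurable_weight_power.
- exact: weight_power_ge0.
- by rewrite ler_pdivlMr// mul1r.
Qed.

Lemma integral_le_LMnorm : (q <= p)%R ->
  (\int[mu]_y (g y * tail_norm q w (enorm y) `^ p)) `^ p^-1 <=
  LMnorm p q v w f.
Proof.
move=> qp; have pn0 : p != 0%R by rewrite gt_eqF.
have qn0 : q != 0%R by rewrite gt_eqF.
have rp : (q^-1 = (p / q) / p)%R by rewrite mulrAC mulfV ?mul1r.
rewrite LMnormE [X in _ <= _ `^ X]rp [leRHS]poweRrM.
apply: le_poweR; first by rewrite invr_ge0 ltW.
  apply: integral_ge0 => t _.
  by rewrite mule_ge0 ?poweR_ge0//; exact: power_density_ge0.
under [leLHS]eq_integral => y _.
  rewrite tail_normE ?enorm_ge0// -poweRrM mulrC; over.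
rewrite -[X in \int[lam]_t (_ * _ `^ X)]invf_div.
apply: minkowski_tail.
- exact: measurable_power_density.
- exact: power_density_ge0.
- exact: measurable_weight_power.
- exact: weight_power_ge0.
- by rewrite ler_pdivlMr// mul1r.
Qed.

(** The integrands of [Lploc] and [LMnorm] agree where [v] is positive, which is almost
    everywhere. *)
Lemma power_density_abse : {ae mu, forall y, `|f y * v y| `^ p = g y}.
Proof.
have := wv.2; apply: filterS => y /(_ I)/andP[v0 _].
by rewrite abseM (gee0_abs (ltW v0)) poweRM// ltW.
Qed.

(** A divergent integral over one ball would be multiplied in [LMnorm_lower] by a positive tail
    norm. Local integrability thus follows from finiteness of the norm, and the embedding reduces to
    an inequality between norms. *)
Lemma LMnorm_lty_Lploc : LMnorm p q v w f < +oo -> Lploc p v f.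
Proof.
move=> LMoo; split => // r r0.
rewrite (ae_eq_integral g).
- rewrite ltey; apply/eqP => Ioo; have := LMnorm_lower (ltW r0).
  rewrite Ioo poweRyr ?invr_neq0 ?gt_eqF// gt0_muley ?tail_norm_gt0 ?(ltW r0)//.
  by rewrite leNgt LMoo.
- exact: measurable_oball0.
- apply: measurable_funTS; apply: (measurableT_comp (measurable_poweR _)).
  have mfv := emeasurable_funM mf wv.1.
  exact: (measurableT_comp (@abse_measurable R setT) mfv).
- by apply: measurable_funTS; exact: measurable_power_density.
- by apply: filterS power_density_abse => y + _.
Qed.

End LMnorm_estimates.

(** * From a bound on [I10] to the inequality between the norms *)

Lemma ae_mrestrP d (T : measurableType d) (R : realType)
    (mu : {measure set T -> \bar R}) (D : set T) (mD : measurable D)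
    (P : T -> Prop) :
  (\forall x \ae mrestr mu mD, P x) <-> (\forall x \ae mu, D x -> P x).
Proof.
split=> [[N [mN N0 NP]]|[N [mN N0 NP]]].
  exists (N `&` D); split => //; first exact: measurableI.
  move=> x /= /not_implyP[Dx nPx]; split => //; exact: NP.
exists (N `|` ~` D); split.
- by apply: measurableU => //; exact: measurableC.
- rewrite /= /mrestr setIUl setICl setU0.
  apply: (subset_measure0 _ mN) => //; first exact: measurableI.
- move=> x /= nPx; have [Dx|] := pselect (D x); last by right.
  by left; apply: NP => /= /(_ Dx).
Qed.

Section I10_bounds.
Context (R : realType) (n : nat) (p q1 q2 : R).
Context (v1 v2 : Rn R n -> \bar R) (w1 w2 : Rline R -> \bar R).
Local Notation mu := (@lebesgue_Rn R n).
Local Notation lam := (@completed_lebesgue_measure R).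
Hypotheses (p0 : (0 < p)%R) (q10 : (0 < q1)%R) (q20 : (0 < q2)%R)
  (wv1 : weight mu setT v1) (wv2 : weight mu setT v2)
  (ww1 : weight lam `]0%R, +oo[ w1) (ww2 : weight lam `]0%R, +oo[ w2).
Local Notation I := (I10 q1 q2 v1 v2 w1 w2).
Local Notation T1 y := (tail_norm q1 w1 (enorm y)).
Local Notation T2 y := (tail_norm q2 w2 (enorm y)).

(** For each positive rational s, the bound with W_2(s) holds for almost every y with |y| < s.
    Outside one common null set it holds for all such s, and letting s decrease to |y| replaces
    W_2(s) by W_2(|y|), by right continuity. *)
Lemma I10_ae (K : R) : (0 < K)%R -> I <= K%:E ->
  {ae mu, forall y, v2 y * T2 y <= K%:E * (v1 y * T1 y)}.
Proof.
move=> K0 IK.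
pose h y := (v1 y)^-1 * v2 y * (T1 y)^-1.
have h_rat (s : rat) : (0 < ratr s :> R)%R ->
    {ae mu, forall y, (enorm y < ratr s)%R ->
      tail_norm q2 w2 (ratr s) * h y <= K%:E}.
  move=> s0; apply/(ae_mrestrP mu (measurable_oball0 _)).
  apply: filterS (ess_sup_ge (mrestr mu (measurable_oball0 (ratr s : R))) h).
  move=> y hy; apply: le_trans IK.
  apply: le_trans (ereal_sup_ubound _); last first.
    by exists (ratr s) => //=; rewrite in_itv/= andbT.
  by rewrite lee_wpmul2l// tail_norm_ge0.
have : {ae mu, forall y, forall k s, unpickle k = Some s ->
    (0 < ratr s :> R)%R -> (enorm y < ratr s)%R ->
    tail_norm q2 w2 (ratr s) * h y <= K%:E}.
  apply/ae_foralln => k; case uk : (unpickle k) => [s|]; last exact: nearW.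
  have [s0|s0] := ltP 0%R (ratr s : R).
    by apply: filterS (h_rat s s0) => y hy _ [<-].
  by apply: nearW => y _ [<-]; rewrite ltNge s0.
apply: filterS3 wv1.2 wv2.2 => y /(_ Logic.I)/andP[v1_gt0 v1oo].
move=> /(_ Logic.I)/andP[v2_gt0 v2oo] hy.
have := tail_norm_gt0 q1 ww1 (enorm_ge0 y).
move: hy; rewrite /h.
case: (v1 y) v1_gt0 v1oo => [a| |]//; rewrite lte_fin => a0 _.
case: (v2 y) v2_gt0 v2oo => [b| |]//; rewrite lte_fin => b0 _.
(* An infinite [T1 y] makes the right side [+oo]. *)
case: (T1 y) => [t| |]//; last first.
  by move=> _ _; rewrite gt0_muley ?lte_fin// gt0_muley ?lte_fin// leey.
move=> /[swap]; rewrite lte_fin => t0.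
rewrite !inver !gt_eqF// -!EFinM => hy.
have c0 : (0 < a^-1 * b / t)%R by rewrite !mulr_gt0 ?invr_gt0.
have : T2 y <= (K / (a^-1 * b / t))%:E.
  apply: (tail_norm_le q20 ww2 (enorm_ge0 y)).
    by rewrite lee_fin divr_ge0 ?ltW.
  move=> x /rat_in_itvoo[s]; rewrite in_itv/= => /andP[ys sx].
  have s0 : (0 < ratr s :> R)%R by exact: le_lt_trans (enorm_ge0 y) ys.
  apply: (le_trans (le_tail_norm q20 ww2 (ltW s0) (ltW sx))).
  rewrite EFinM -[_^-1%:E]/((a^-1 * b / t)^-1%:E).
  have := hy _ _ (pickleK s) s0 ys.
  case: (tail_norm q2 w2 (ratr s)) => [z||]; last by rewrite leNye.
    by rewrite -!EFinM !lee_fin ler_pdivlMr.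
  by rewrite gt0_mulye ?lte_fin// leye_eq.
case: (T2 y) => [z||]; last 2 first.
- by rewrite leye_eq.
- by move=> _; rewrite gt0_muleNy ?lte_fin// leNye.
rewrite -!EFinM !lee_fin ler_pdivlMr// => H.
rewrite -(ler_pM2r (_ : 0 < a^-1 / t)%R); last by rewrite mulr_gt0 ?invr_gt0.
rewrite (_ : K * (a * t) * (a^-1 / t) = K)%R; last first.
  by field; rewrite !gt_eqF.
by apply: le_trans H; rewrite le_eqVlt; apply/orP; left; apply/eqP; ring.
Qed.

Lemma LMnorm_le (K : R) (f : Rn R n -> \bar R) : (0 < K)%R -> I <= K%:E ->
  (q1 <= p)%R -> (p <= q2)%R -> measurable_fun setT f ->
  LMnorm p q2 v2 w2 f <= K%:E * LMnorm p q1 v1 w1 f.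
Proof.
move=> K0 IK q1p pq2 mf.
have pn0 : p != 0%R by rewrite gt_eqF.
pose F v q w y := power_density p v f y * tail_norm q w (enorm y) `^ p.
have F0 v q w y : 0 <= F v q w y.
  by rewrite mule_ge0 ?poweR_ge0//; exact: power_density_ge0.
have mF1 : measurable_fun setT (F v1 q1 w1).
  apply: emeasurable_funM; first exact: measurable_power_density.
  apply: (measurableT_comp (measurable_poweR _)).
  exact: measurable_tail_norm.
have mF2 : measurable_fun setT (F v2 q2 w2).
  apply: emeasurable_funM; first exact: measurable_power_density.
  apply: (measurableT_comp (measurable_poweR _)).
  exact: measurable_tail_norm.
apply: (le_trans (LMnorm_le_integral p0 q20 wv2 ww2 mf pq2)).
apply: (@le_trans _ _ (K%:E * (\int[mu]_y F v1 q1 w1 y) `^ p^-1)); last first.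
  rewrite lee_wpmul2l ?lee_fin ?(ltW K0)//.
  exact: (integral_le_LMnorm p0 q10 wv1 ww1 mf q1p).
have K0' : 0 <= K%:E by rewrite lee_fin ltW.
rewrite -[X in X * _](poweRK pn0 K0').
rewrite -poweRM ?poweR_ge0//; last exact: integral_ge0.
apply: le_poweR; first by rewrite invr_ge0 ltW.
  by apply: integral_ge0 => y _; exact: F0.
rewrite -ge0_integralZl ?poweR_ge0//.
have mKF1 := measurable_funeM (K%:E `^ p) mF1.
apply: (ae_ge0_le_integral measurableT (fun y _ => F0 v2 q2 w2 y) mF2 _ mKF1).
  by move=> y _; rewrite mule_ge0 ?poweR_ge0.
apply: filterS3 (I10_ae K0 IK) wv1.2 wv2.2 => y H /(_ Logic.I)/andP[v10 _].
move=> /(_ Logic.I)/andP[v20 _] _.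
have FE v q w : 0 <= v y ->
    F v q w y = `|f y| `^ p * (v y * tail_norm q w (enorm y)) `^ p.
  by move=> v0; rewrite /F /power_density (poweRM _ v0) ?tail_norm_ge0// muleA.
rewrite (FE _ _ _ (ltW v20)) (FE _ _ _ (ltW v10)) muleCA.
rewrite lee_wpmul2l ?poweR_ge0// -poweRM//; last first.
  by rewrite mule_ge0 ?tail_norm_ge0 ?(ltW v10).
apply: le_poweR => //; first exact: ltW.
by rewrite mule_ge0 ?tail_norm_ge0 ?(ltW v20).
Qed.

End I10_bounds.

(** * Test functions and the bound on [I10] *)

Section test_functions.
Context (R : realType) (n : nat) (p q1 q2 : R).
Context (v1 v2 : Rn R n -> \bar R) (w1 w2 : Rline R -> \bar R).
Local Notation mu := (@lebesgue_Rn R n).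
Local Notation lam := (@completed_lebesgue_measure R).
Hypotheses (p0 : (0 < p)%R) (q10 : (0 < q1)%R) (q20 : (0 < q2)%R)
  (wv1 : weight mu setT v1) (wv2 : weight mu setT v2)
  (ww1 : weight lam `]0%R, +oo[ w1) (ww2 : weight lam `]0%R, +oo[ w2)
  (w2oo : forall t : R, (0 < t)%R ->
      \int[lam]_(s in `]t, +oo[) (w2 s `^ q2) < +oo).
Local Notation I := (I10 q1 q2 v1 v2 w1 w2).
Local Notation T1 y := (tail_norm q1 w1 (enorm y)).

(** The power -1 is nonnegative everywhere, and it is the inverse of [v1] on the sets [A] used
    below, where [v1] is positive and finite. The first norm then sees [A] only through its measure,
    the second through v2 / v1. *)
Definition test_fun (A : set (Rn R n)) : Rn R n -> \bar R :=
  (fun y => v1 y `^ (- 1)) \_ A.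

Section test_fun.
Variable A : set (Rn R n).
Hypotheses (mA : measurable A) (v1A : forall y, A y -> 0 < v1 y < +oo).

Lemma test_fun_Mplus : Mplus (test_fun A).
Proof.
split; last by move=> y; apply: erestrict_ge0 => z _; exact: poweR_ge0.
apply/(measurable_restrictT _ mA); apply: measurable_funTS.
by apply: (measurableT_comp (measurable_poweR _)); exact: wv1.1.
Qed.

Lemma test_funK y : A y -> test_fun A y * v1 y = 1.
Proof.
move=> Ay; rewrite /test_fun patchE mem_set//.
case: (v1 y) (v1A Ay) => [r|/andP[_]|/andP[]]//.
rewrite lte_fin => /andP[r0 _].
by rewrite poweR_EFin powR_inv1 ?ltW// -EFinM mulVf ?gt_eqF.
Qed.

Lemma power_density_test_fun y :
  power_density p v1 (test_fun A) y = (\1_A y)%:E.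
Proof.
have f0 := test_fun_Mplus.2 y.
rewrite /power_density gee0_abs// indicE.
have [/set_mem Ay|/negP Ay] := boolP (y \in A).
  have /andP[v0 _] := v1A Ay.
  by rewrite -poweRM ?(ltW v0)// test_funK// poweR1r.
rewrite /test_fun patchE ifN; last exact/negP.
(* Outside [A] the restriction takes the default value [point], which is 0. *)
by rewrite -[point]/(0 : \bar R) poweR0r ?mul0e// gt_eqF.
Qed.

(** Let z be the infimum of |y| over [A]. Balls of radius at most z miss [A], and larger ones meet
    it in measure at most [mu A], so the norm is at most W_1(z) times the power of [mu A]. *)
Lemma LMnorm_test_fun_le (c : \bar R) : A !=set0 -> 0 <= c ->
  (forall y, A y -> T1 y <= c) ->
  LMnorm p q1 v1 w1 (test_fun A) <= c * mu A `^ p^-1.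
Proof.
move=> [y0 Ay0] c0 T1c.
have q1n0 : q1 != 0%R by rewrite gt_eqF.
pose z := inf [set enorm y | y in A].
have zinf : has_inf [set enorm y | y in A].
  split; first by exists (enorm y0); exists y0.
  by exists 0%R => _ [y _ <-]; exact: enorm_ge0.
have z0 : (0 <= z)%R.
  by apply: lb_le_inf; [exact: zinf.1|move=> _ [y _ <-]; exact: enorm_ge0].
(* The infimum need not be attained, but each x > z exceeds |y| for some y in [A]; hence W_1(x) <=
   W_1(|y|) <= c, and right continuity reaches z. *)
have Tz : tail_norm q1 w1 z <= c.
  apply: (tail_norm_le q10 ww1 z0 c0) => x zx.
  have xz0 : (0 < x - z)%R by rewrite subr_gt0.
  have [_ [y Ay <-]] := inf_adherent xz0 zinf.
  rewrite addrC subrK => yx; apply: le_trans (T1c _ Ay).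
  exact: (le_tail_norm q10 ww1 (enorm_ge0 y) (ltW yx)).
have mw := measurable_weight_power q1 ww1; have w0 := weight_power_ge0 q1 w1.
rewrite LMnormE.
have -> : c * mu A `^ p^-1 = (c `^ q1 * mu A `^ (q1 / p)) `^ q1^-1.
  rewrite poweRM ?poweR_ge0// poweRK// -poweRrM.
  by rewrite mulrAC mulfV// mul1r.
apply: le_poweR; first by rewrite invr_ge0 ltW.
  by apply: integral_ge0 => t _; rewrite mule_ge0 ?poweR_ge0.
apply: (@le_trans _ _
    (\int[lam]_(t in `]z, +oo[) (mu A `^ (q1 / p) * weight_power q1 w1 t))).
  have mz := measurable_itv_Rline `]z, +oo[.
  rewrite [leRHS]integral_mkcond.
  have mI : measurable_fun setT (fun t : Rline R =>
      (\int[mu]_(y in oball0 t) power_density p v1 (test_fun A) y) `^ (q1 / p)).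
    apply: (measurableT_comp (measurable_poweR _)).
    apply: measurable_integral_oball0; last exact: power_density_ge0.
    exact: (measurable_power_density p wv1 test_fun_Mplus.1).
  have mJ := (measurable_restrictT _ mz).1
    (measurable_funTS (measurable_funeM (mu A `^ (q1 / p)) mw)).
  apply: (ge0_le_integral lam measurableT _ (emeasurable_funM mw mI) mJ).
  - by move=> t _; rewrite mule_ge0 ?poweR_ge0.
  - move=> t _; rewrite patchE.
    under eq_integral do rewrite power_density_test_fun.
    rewrite integral_indic; last 2 first.
    + exact: measurable_oball0.
    + exact: mA.
    case: ifPn => [_|].
      rewrite muleC lee_wpmul2r//; apply: le_poweR => //.
        by rewrite divr_ge0 ?ltW.
      apply: le_measure; rewrite ?inE//.
      by apply: measurableI => //; exact: measurable_oball0.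
    rewrite notin_setE/= in_itv/= andbT => /negP; rewrite -leNgt => tz.
    rewrite (_ : A `&` oball0 t = set0) ?measure0 ?poweR0r ?mule0//.
      by rewrite mulf_neq0 ?invr_neq0 ?gt_eqF.
    apply/seteqP; split => // y [Ay]; rewrite /oball0/= => yt.
    have : (z <= enorm y)%R by apply: ge_inf; [exact: zinf.2|exists y].
    by rewrite leNgt (lt_le_trans yt).
rewrite ge0_integralZl ?poweR_ge0//; last 2 first.
- exact: measurable_itv_Rline.
- exact: measurable_funTS.
rewrite muleC lee_wpmul2r ?poweR_ge0//.
have Iw : 0 <= \int[lam]_(t in `]z, +oo[) weight_power q1 w1 t.
  exact: integral_ge0.
rewrite -[leLHS](poweRVK q1n0 Iw) -tail_normE//.
by apply: le_poweR => //; rewrite ?(ltW q10)// tail_norm_ge0.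
Qed.

Lemma le_LMnorm_test_fun (x c : R) : (0 <= x)%R -> (0 <= c)%R ->
  A `<=` oball0 x -> (forall y, A y -> c%:E * v1 y <= v2 y) ->
  tail_norm q2 w2 x * c%:E * mu A `^ p^-1 <= LMnorm p q2 v2 w2 (test_fun A).
Proof.
move=> x0 c0 Ax cv.
have pn0 : p != 0%R by rewrite gt_eqF.
apply: le_trans (LMnorm_lower p0 q20 wv2 ww2 test_fun_Mplus.1 x0).
rewrite -muleA lee_wpmul2l ?tail_norm_ge0//.
have c0' : 0 <= c%:E by rewrite lee_fin.
rewrite -[X in X * _](poweRK pn0 c0') -poweRM ?poweR_ge0//.
apply: le_poweR; first by rewrite invr_ge0 ltW.
  by rewrite mule_ge0 ?poweR_ge0.
have mx := measurable_oball0 (n := n) x.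
have m1A : measurable_fun (oball0 x) (fun y : Rn R n => (\1_A y)%:E : \bar R).
  by apply/measurable_EFinP; exact: measurable_indic.
have m2 := measurable_power_density p wv2 test_fun_Mplus.1.
rewrite -{1}(setIidl Ax) -(integral_indic mu mx mA).
rewrite -(ge0_integralZl mu mx m1A) ?poweR_ge0//.
apply: (ge0_le_integral mu mx _ (measurable_funeM _ m1A) (measurable_funTS m2)).
  by move=> y _; rewrite mule_ge0 ?poweR_ge0 ?lee_fin.
move=> y _; rewrite indicE.
have [/set_mem Ay|Ay] := boolP (y \in A); last first.
  by rewrite mule0; exact: power_density_ge0.
have f0 := test_fun_Mplus.2 y.
have v2_ge0 : 0 <= v2 y.
  apply: le_trans (cv _ Ay); rewrite mule_ge0//.
  by have /andP[/ltW] := v1A Ay.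
rewrite mule1 /power_density gee0_abs// -poweRM//; apply: le_poweR => //.
  exact: ltW.
rewrite -[leLHS]mule1 -(test_funK Ay) muleCA lee_wpmul2l//.
exact: cv.
Qed.

End test_fun.

Section test_bound.
Variables C K : R.
Hypotheses (C0 : (0 <= C)%R) (CK : (C < K)%R)
  (bound : forall f, Mplus f -> LMnorm p q1 v1 w1 f < +oo ->
    LMnorm p q2 v2 w2 f <= C%:E * LMnorm p q1 v1 w1 f).

(** With m the power of [mu A], the first norm of the test function is at most 2cm and the second at
    least t (2Kc/t) m = K (2cm). A positive finite m would give K <= C. *)
Lemma test_set_null (x c t : R) (A : set (Rn R n)) : (0 < x)%R -> (0 < c)%R ->
  (0 < t)%R -> tail_norm q2 w2 x = t%:E ->
  measurable A -> mu A < +oo -> A `<=` oball0 x ->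
  (forall y, A y -> 0 < v1 y < +oo) -> (forall y, A y -> T1 y <= (2 * c)%:E) ->
  (forall y, A y -> (2 * K * c / t)%:E * v1 y <= v2 y) -> mu A = 0.
Proof.
move=> x0 c0 t0 xt mA Aoo Ax v1A T1A v2A; apply/eqP; apply: contraPT isT => A0.
have K0 : (0 < K)%R by exact: le_lt_trans CK.
have An0 : A !=set0.
  by apply/set0P; apply: contra_neq A0 => ->; rewrite measure0.
have c20 : 0 <= (2 * c)%:E by rewrite lee_fin mulr_ge0 ?ltW.
have m_gt0 : 0 < mu A `^ p^-1 by rewrite poweR_gt0// lt0e A0/=.
have m_oo : mu A `^ p^-1 < +oo by exact: poweR_lty.
have N1 := LMnorm_test_fun_le mA v1A An0 c20 T1A.
have c'0 : (0 <= 2 * K * c / t)%R.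
  by apply: divr_ge0; [apply: mulr_ge0; [apply: mulr_ge0|]|]; rewrite // ltW.
have N2 := le_LMnorm_test_fun mA v1A (ltW x0) c'0 Ax v2A.
have N1oo : LMnorm p q1 v1 w1 (test_fun A) < +oo.
  by apply: le_lt_trans N1 _; rewrite lte_mul_pinfty.
have := le_trans N2 (le_trans (bound (test_fun_Mplus mA) N1oo)
  (lee_wpmul2l (_ : 0 <= C%:E) N1)).
rewrite lee_fin => /(_ C0); rewrite xt.
case: (mu A `^ p^-1) m_gt0 m_oo => [m| |]//; rewrite lte_fin => m0 _.
rewrite -!EFinM lee_fin.
rewrite (_ : t * (2 * K * c / t) * m = K * (2 * c * m))%R; last first.
  by field; rewrite gt_eqF.
rewrite ler_pM2r ?mulr_gt0//.
by rewrite leNgt CK.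
Qed.

(** Fix x and let t = W_2(x). The points of the ball where v2 / (v1 W_1) exceeds 2K/t lie, up to a
    null set, in countably many sets to which [test_set_null] applies. Assuming [bound] only for
    finite first norm lets it come either from an embedding or from the norm of the identity. *)
Lemma I10_le : I <= (2 * K)%:E.
Proof.
have K0 : (0 < K)%R by exact: le_lt_trans CK.
apply: ge_ereal_sup => _ [x /= + <-]; rewrite in_itv/= andbT => x0.
have := tail_norm_gt0 q2 ww2 (ltW x0).
have := tail_norm_lty (w2oo x0).
case xt : (tail_norm q2 w2 x) => [t| |]// _; rewrite lte_fin => t0.
have M0 : (0 < 2 * K / t)%R by rewrite divr_gt0 ?mulr_gt0.
suff H : ess_sup (mrestr mu (measurable_oball0 x))
    (fun y => (v1 y)^-1 * v2 y * (T1 y)^-1) <= (2 * K / t)%:E.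
  apply: (@le_trans _ _ (t%:E * (2 * K / t)%:E)).
    by rewrite lee_wpmul2l// lee_fin ltW.
  by rewrite -EFinM lee_fin mulrC divfK ?gt_eqF.
apply/ess_supP; apply/ae_mrestrP.
have /sigma_finiteP[F [TF _ Foo]] := sigma_finiteT mu.
(* Intersecting with [F m] makes the measure finite. Only the one-sided inequalities needed by the
   test are recorded; the two-sided localization of W_1 enters in the choice of [s] below. *)
pose A (c : R) (m : nat) : set (Rn R n) :=
  (oball0 x `&` F m) `&` ([set y | 0 < v1 y] `&` [set y | v1 y < +oo]) `&`
  ([set y | T1 y <= (2 * c)%:E] `&`
   [set y | (2 * K * c / t)%:E * v1 y <= v2 y]).
have mA c m : measurable (A c m).
  have mT1 := @measurable_tail_norm _ q1 _ ww1 n.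
  have mc (k : \bar R) : measurable_fun setT (fun=> k : \bar R) :=
    @measurable_cst _ _ (Rn R n) _ setT k.
  apply: measurableI; [apply: measurableI|apply: measurableI].
  - by apply: measurableI; [exact: measurable_oball0|have [] := Foo m].
  - apply: measurableI; rewrite -[X in measurable X]setTI.
      exact: (measurable_lte measurableT (mc 0) wv1.1).
    exact: (measurable_lte measurableT wv1.1 (mc +oo)).
  - rewrite -[X in measurable X]setTI.
    exact: (measurable_lee measurableT mT1 (mc _)).
  - rewrite -[X in measurable X]setTI.
    exact: (measurable_lee measurableT (measurable_funeM _ wv1.1) wv2.1).
have A0 c m : (0 < c)%R -> mu (A c m) = 0.
  move=> c0; apply: (test_set_null x0 c0 t0 xt (mA c m)).
  - apply: (@le_lt_trans _ _ (mu (F m))); last by have [] := Foo m.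
    apply: le_measure; rewrite ?inE//; first by have [] := Foo m.
    by move=> y [[[]]].
  - by move=> y [[[]]].
  - by move=> y [[_ [/= -> ->]]].
  - by move=> y [_ []].
  - by move=> y [_ []].
have : {ae mu, forall y, forall k m s, unpickle k = Some s ->
    (0 < ratr s :> R)%R -> ~ A (ratr s) m y}.
  apply/ae_foralln => k; apply/ae_foralln => m.
  case uk : (unpickle k) => [s|]; last exact: nearW.
  have [s0|s0] := ltP 0%R (ratr s : R).
    exists (A (ratr s) m); split => //; first exact: A0.
    move=> y /= nA; apply: contrapT => nAy; apply: nA => _ [<-] _; exact: nAy.
  by apply: nearW => y _ [<-]; rewrite ltNge s0.
apply: filterS3 wv1.2 wv2.2 => y /(_ Logic.I)/andP[v10 v1oo].
move=> /(_ Logic.I)/andP[v20 v2oo] nA yx.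
have T1_gt0 := tail_norm_gt0 q1 ww1 (enorm_ge0 y).
have [m _ Fm] : (\bigcup_i F i) y by rewrite -TF.
rewrite leNgt; apply/negP => hy.
(* An infinite [T1 y] has inverse 0, and [hy] would put 0 above [2 * K / t]. *)
have T1oo : T1 y < +oo.
  rewrite ltey; apply/eqP => T1oo; move: hy; rewrite T1oo invey mule0 lte_fin.
  by rewrite ltNge ltW.
have [u u0 uE] : exists2 u : R, (0 < u)%R & T1 y = u%:E.
  by case: (T1 y) T1_gt0 T1oo => [u| |]//; rewrite lte_fin => u0 _; exists u.
(* With u = W_1(|y|), the bound u < 2s puts [y] below the level [2 * c] for c = s, while s < u gives
   v2 >= (2Ku/t) v1 >= (2Ks/t) v1. *)
have [s] : exists s : rat, ratr s \in `]u / 2, u[%R.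
  have /rat_in_itvoo[s su] : (u / 2 < u)%R.
    by rewrite ltr_pdivrMr// ltr_pMr// ltr1n.
  by exists s.
rewrite in_itv/= => /andP[us su].
have s0 : (0 < ratr s :> R)%R by apply: lt_trans us; rewrite divr_gt0.
apply: (nA _ m _ (pickleK s) s0); split; first by split.
split => /=.
  by rewrite uE lee_fin mulrC -ler_pdivrMr// ltW.
move: hy; rewrite uE.
case: (v1 y) v10 v1oo => [a| |]//; rewrite lte_fin => a0 _.
case: (v2 y) v20 v2oo => [b| |]//; rewrite lte_fin => b0 _.
rewrite !inver !gt_eqF// -!EFinM lte_fin lee_fin => hy.
apply: (@le_trans _ _ ((2 * K / t) * (a * u)))%R.
  rewrite (_ : 2 * K * ratr s / t * a = 2 * K / t * (a * ratr s))%R; last ring.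
  by rewrite !ler_pM2l// ltW.
apply: (@le_trans _ _ ((a^-1 * b / u) * (a * u)))%R.
  by rewrite ler_pM2r ?mulr_gt0// ltW.
by rewrite le_eqVlt; apply/orP; left; apply/eqP; field; rewrite !gt_eqF.
Qed.

End test_bound.

End test_functions.

(** * Existence of a ball of positive measure *)

Lemma borel_lebesgue_setT_gt0 (R : realType) (n : nat) :
  0 < borel_lebesgue R n setT.
Proof.
elim: n => [|n IHn]; first by rewrite /= diracT lte01.
rewrite /= /lebesgue_cons /pushforward preimage_setT -setXTT.
rewrite product_measure1E// mule_gt0//.
suff : 0 < lebesgue_measure [set: R] by [].
have := @lebesgue_measure_itv R `]-oo, +oo[.
by rewrite set_itvNyy /= => ->; rewrite adde_gt0.
Qed.

Lemma lebesgue_Rn_setT_gt0 (R : realType) (n : nat) :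
  0 < @lebesgue_Rn R n setT.
Proof.
by rewrite /lebesgue_Rn /completed_measure_extension measurable_mu_extE//;
  exact: borel_lebesgue_setT_gt0.
Qed.

(** R^n is the union of the balls of positive integer radius. If all were null, so would R^n be; no
    volume has to be computed. *)
Lemma oball0_measure_gt0 (R : realType) (n : nat) :
  exists2 x : R, (0 < x)%R & 0 < @lebesgue_Rn R n (oball0 x).
Proof.
apply: contrapT => H.
have B0 (k : nat) : @lebesgue_Rn R n (oball0 k.+1%:R) = 0.
  apply/eqP; apply: contrapT => /negP Bk; apply: H.
  by exists k.+1%:R => //; rewrite lt0e Bk/=.
have := lebesgue_Rn_setT_gt0 R n.
suff -> : @lebesgue_Rn R n setT = 0 by rewrite ltxx.
have TB : setT = \bigcup_k oball0 k.+1%:R :> set (Rn R n).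
  apply/seteqP; split => // y _.
  exists (Num.truncn (enorm y)) => //=; rewrite /oball0/=.
  by rewrite truncnS_gt.
apply/eqP; rewrite -measure_le0 TB.
apply: (le_trans (measure_sigma_subadditive _ _ _ (@subset_refl _ _))).
- by move=> k; exact: measurable_oball0.
- by apply: bigcup_measurable => k _; exact: measurable_oball0.
- by rewrite eseries0// => k _ _; exact: B0.
Qed.

(** * The embedding criterion and the norm of the identity *)

Section main.
Context (R : realType) (n : nat) (p q1 q2 : R).
Context (v1 v2 : Rn R n -> \bar R) (w1 w2 : Rline R -> \bar R).
Local Notation mu := (@lebesgue_Rn R n).
Local Notation lam := (@completed_lebesgue_measure R).
Hypotheses (q10 : (0 < q1)%R) (q1p : (q1 <= p)%R) (pq2 : (p < q2)%R)
  (wv1 : weight mu setT v1) (wv2 : weight mu setT v2)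
  (ww1 : weight lam `]0%R, +oo[ w1) (ww2 : weight lam `]0%R, +oo[ w2)
  (w2oo : forall t : R, (0 < t)%R ->
      \int[lam]_(s in `]t, +oo[) (w2 s `^ q2) < +oo).
Local Notation I := (I10 q1 q2 v1 v2 w1 w2).
Local Notation N1 := (LMnorm p q1 v1 w1).
Local Notation N2 := (LMnorm p q2 v2 w2).
Local Notation N := (LM_identity_norm p q1 p q2 v1 v2 w1 w2).

Let p0 : (0 < p)%R. Proof. exact: lt_le_trans q1p. Qed.
Let q20 : (0 < q2)%R. Proof. exact: lt_trans pq2. Qed.

(* Balls must have positive measure here: the essential supremum over a null
   set is [-oo]. *)
Lemma I10_ge0 : 0 <= I.
Proof.
have [x x0 Bx] := oball0_measure_gt0 R n.
apply: le_trans (ereal_sup_ubound _); last first.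
  by exists x => //=; rewrite in_itv/= andbT.
rewrite mule_ge0 ?tail_norm_ge0//; apply: ess_sup_gee.
  by rewrite /= /mrestr setTI.
apply/ae_mrestrP; apply: filterS2 wv1.2 wv2.2.
move=> y /(_ Logic.I)/andP[v10 _] /(_ Logic.I)/andP[v20 _] _.
by rewrite !mule_ge0 ?inve_ge0 ?tail_norm_ge0 ?ltW.
Qed.

Lemma LM_quotient_le f : Mplus f -> N2 f / N1 f <= I.
Proof.
move=> [mf _]; have := I10_ge0.
have [->|] := eqVneq I +oo; first by rewrite !leey.
rewrite -ltey => Ioo I0; have Ifin : I \is a fin_num by rewrite ge0_fin_numE.
(* The slack [e] provides the positive constant required by [LMnorm_le]; it is removed in the
   limit. *)
have bound (e : R) : (0 < e)%R -> N2 f <= (fine I + e)%:E * N1 f.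
  move=> e0; apply: LMnorm_le => //; last exact: ltW.
    by rewrite ltr_wpDl// fine_ge0.
  by rewrite EFinD fineK// leeDl// lee_fin ltW.
have := LMnorm_ge0 p q1 v1 f w1; have := LMnorm_ge0 p q2 v2 f w2.
case: (N1 f) bound => [r| |]//; last by move=> _ _ _; rewrite invey mule0.
move=> bound N20; rewrite lee_fin le_eqVlt => /predU1P[r0|r0].
  (* If the first norm vanishes, so does the second, and the quotient is 0 / 0 = 0. *)
  have := bound 1%R ltr01; rewrite -r0 mule0 => N2le.
  have -> : N2 f = 0 by apply/eqP; rewrite eq_le N2le.
  by rewrite mul0e.
apply/lee_addgt0Pr => e e0; rewrite inver gt_eqF// lee_pdivrMr//.
by rewrite -(fineK Ifin) -EFinD; exact: bound.
Qed.

Lemma I10_finite_embedded : I < +oo ->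
  embedded (LM p q1 v1 w1) (LM p q2 v2 w2) N1 N2.
Proof.
move=> Ioo; have I0 := I10_ge0.
have Ifin : I \is a fin_num by rewrite ge0_fin_numE.
have K0 : (0 < fine I + 1)%R by rewrite ltr_wpDl// fine_ge0.
have IK : I <= (fine I + 1)%:E by rewrite EFinD fineK// leeDl.
have bound f : measurable_fun setT f -> N2 f <= (fine I + 1)%:E * N1 f.
  by apply: LMnorm_le => //; exact: ltW.
split; last by exists (fine I + 1)%R => // f [[mf _] _]; exact: bound.
move=> f [[mf _] f1]; have f2 : N2 f < +oo.
  by apply: le_lt_trans (bound f mf) _; rewrite lte_mul_pinfty// lee_fin ltW.
by split => //; exact: (LMnorm_lty_Lploc p0 q20 wv2 ww2 mf).
Qed.

Lemma embedded_I10_finite :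
  embedded (LM p q1 v1 w1) (LM p q2 v2 w2) N1 N2 -> I < +oo.
Proof.
move=> [_ [C C0 bound]].
(* Any number above [C] serves, since only finiteness is claimed. *)
have CK : (C < C + 1)%R by rewrite ltrDl.
apply: (le_lt_trans (I10_le p0 q10 q20 wv1 wv2 ww1 ww2 w2oo (ltW C0) CK _)).
  move=> f [mf _] f1; apply: bound; split => //.
  exact: (LMnorm_lty_Lploc p0 q10 wv1 ww1 mf).
by rewrite ltry.
Qed.

Lemma LM_identity_norm_le : N <= I.
Proof. by apply: ge_ereal_sup => _ [f Mf <-]; exact: LM_quotient_le. Qed.

Lemma LM_quotient_ge0 f : 0 <= N2 f / N1 f.
Proof. by rewrite mule_ge0 ?inve_ge0 ?LMnorm_ge0. Qed.

Lemma LM_identity_norm_ge0 : 0 <= N.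
Proof.
apply: le_trans (LM_quotient_ge0 (cst 0)) (ereal_sup_ubound _).
by exists (cst 0) => //; split => //; exact: measurable_cst.
Qed.

Lemma I10_le_LM_identity_norm : I <= 2%:E * N.
Proof.
have := LM_identity_norm_ge0.
have [->|] := eqVneq N +oo; first by rewrite gt0_muley ?lte_fin// !leey.
rewrite -ltey => Noo N0; have Nfin : N \is a fin_num by rewrite ge0_fin_numE.
have C0 : (0 <= fine N)%R by exact: fine_ge0.
have bound f : Mplus f -> N1 f < +oo -> N2 f <= (fine N)%:E * N1 f.
  move=> Mf f1; have : N2 f / N1 f <= N by apply: ereal_sup_ubound; exists f.
  rewrite fineK//; have := LMnorm_ge0 p q1 v1 f w1.
  have := LMnorm_ge0 p q2 v2 f w2.
  case: (N1 f) f1 => [r| |]// _ N20.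
  rewrite lee_fin le_eqVlt => /predU1P[<-|r0].
    (* A positive second norm over a vanishing first one would be a quotient equal to [+oo], against
       the finiteness of [N]. *)
    have [->|N2n0] := eqVneq (N2 f) 0; first by rewrite mule0.
    rewrite inve0 gt0_muley ?leye_eq; last by rewrite lt0e N2n0.
    by move/eqP => Ny; move: Noo; rewrite Ny ltxx.
  by rewrite inver gt_eqF// lee_pdivrMr.
apply/lee_addgt0Pr => e e0.
(* The slack is halved because [I10_le] doubles it. *)
have CK : (fine N < fine N + e / 2)%R by rewrite ltrDl divr_gt0.
apply: (le_trans (I10_le p0 q10 q20 wv1 wv2 ww1 ww2 w2oo C0 CK bound)).
by rewrite mulrDr mulrCA mulfV// mulr1 EFinD EFinM fineK.
Qed.

End main.

Theorem theorem3p5 (R : realType) (n : nat) (p1 p2 q1 q2 : R)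
    (n1 : (1 <= n)%N) (q1_gt0 : (0 < q1)%R) (q1p1 : (q1 <= p1)%R)
    (p1p2 : p1 = p2) (p2q2 : (p2 < q2)%R) :
  exists2 lambda : R, (0 < lambda)%R &
  forall (v1 v2 : Rn R n -> \bar R) (w1 w2 : Rline R -> \bar R),
    weight (@lebesgue_Rn R n) setT v1 ->
    weight (@lebesgue_Rn R n) setT v2 ->
    weight (@completed_lebesgue_measure R) `]0%R, +oo[ w1 ->
    weight (@completed_lebesgue_measure R) `]0%R, +oo[ w2 ->
    (forall t : R, (0 < t)%R ->
      \int[@completed_lebesgue_measure R]_(s in `]t, +oo[) (w1 s `^ q1) < +oo) ->
    (forall t : R, (0 < t)%R ->
      \int[@completed_lebesgue_measure R]_(s in `]t, +oo[) (w2 s `^ q2) < +oo) ->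
    (embedded (LM p1 q1 v1 w1) (LM p2 q2 v2 w2)
       (LMnorm p1 q1 v1 w1) (LMnorm p2 q2 v2 w2)
     <-> I10 q1 q2 v1 v2 w1 w2 < +oo)
    /\ equiv_up_to lambda (LM_identity_norm p1 q1 p2 q2 v1 v2 w1 w2)
         (I10 q1 q2 v1 v2 w1 w2).
Proof.
(* The lower estimate of the norm costs the factor 2 of [I10_le]; the upper one holds with constant
   1. *)
subst p2; exists 2%R; first exact: ltr0n.
move=> v1 v2 w1 w2 wv1 wv2 ww1 ww2 _ w2oo.
split; first split.
- exact: (embedded_I10_finite q1_gt0 q1p1 p2q2 wv1 wv2 ww1 ww2 w2oo).
- exact: (I10_finite_embedded q1_gt0 q1p1 p2q2 wv1 wv2 ww1 ww2).
apply/andP; split.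
  rewrite muleC -[_^-1%:E]/(2^-1%:E) lee_pdivrMr// muleC.
  exact: (I10_le_LM_identity_norm q1_gt0 q1p1 p2q2 wv1 wv2 ww1 ww2 w2oo).
apply: (le_trans (LM_identity_norm_le q1_gt0 q1p1 p2q2 wv1 wv2 ww1 ww2)).
rewrite -[leLHS]mul1e lee_wpmul2r ?lee_fin ?ler1n//.
exact: (I10_ge0 _ _ _ _ wv1 wv2).
Qed.
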